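(* Let $v=\sum_k\alpha_kv^k$ be the collective Llull matrix on a finite set $A$ of finitely many individual votes $v^k$ (Llull matrices on $A$) with weights $\alpha_k\ge0$, $\sum_k\alpha_k=1$. Let $C\subseteq A$ be a cluster for all of the individual votes $v^k$. Then $C$ is a cluster for the ranking defined by the rank-like rates of $v$, i.e. for the relation $\sigma=\{xy: x,y\in A,\ x\ne y,\ r_x<r_y\}$.
   Context: Let $A$ be a finite set with $N$ elements and $\Pi$ the set of ordered pairs $xy$ with $x,y\in A$, $x\ne y$. A relation on $A$ is a subset of $\Pi$. A Llull matrix on $A$ is a family $v=(v_{xy})_{xy\in\Pi}$ with $v_{xy}\in[0,1]$ and $v_{xy}+v_{yx}\le1$. Turnovers: $t_{xy}=v_{xy}+v_{yx}$. Clusters: $C\subseteq A$ is a cluster for a system of binary scores $(v_{xy})$ when $v_{ax}=v_{bx}$ and $v_{xa}=v_{xb}$ whenever $a,b\in C$ and $x\notin C$. $C$ is a cluster for a relation $\rho\subseteq\Pi$ when, for any $x\notin C$, having $ax\in\rho$ for some $a\in C$ implies $bx\in\rho$ for all $b\in C$, and having $xa\in\rho$ for some $a\in C$ implies $xb\in\rho$ for all $b\in C$. Indirect scores: $v^*_{xy}=\max\min_{0\le i<n}v_{x_ix_{i+1}}$, the max being over all paths $x_0x_1\dots x_n$ ($n\ge1$, consecutive elements distinct) with $x_0=x$, $x_n=y$. Put $m^\nu_{xy}=v^*_{xy}-v^*_{yx}$, $\nu=\{xy\in\Pi: m^\nu_{xy}>0\}$, $\hat\nu=\{xy\in\Pi: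 m^\nu_{xy}\ge0\}$. An admissible order is a (strict) total order $\xi\subseteq\Pi$ with $\nu\subseteq\xi\subseteq\hat\nu$; one always exists. Write $x\succ y$ for $xy\in\xi$, $x\succeq y$ for $x\succ y$ or $x=y$, and $x'$ for the immediate successor of $x$ in $\xi$ (for $x$ not last). Given an admissible order $\xi$, the projected scores are obtained as follows. (i) For $x\succ y$: $m^\sigma_{xy}=\min\{m^\nu_{pq}: p\succeq x,\ y\succeq q\}$. (ii) $(t^\sigma_{xy})_{xy\in\Pi}$ is the unique minimizer of $\sum_{xy\in\Pi}(\tau_{xy}-t_{xy})^2$ among all real families $(\tau_{xy})_{xy\in\Pi}$ such that $\tau_{xy}=\tau_{yx}$ for all $xy$; $m^\sigma_{xx'}\le\tau_{xx'}\le1$ for all non-last $x$; $0\le\tau_{xy}-\tau_{xy'}\le m^\sigma_{yy'}$ for all non-last $y$ and all $x\notin\{y,y'\}$. (iii) $\gamma_{xx'}=[(t^\sigma_{xx'}-m^\sigma_{xx'})/2,\ (t^\sigma_{xx'}+m^\sigma_{xx'})/2]$, and for $x\succ y$, $\gamma_{xy}=\bigcup\{\gamma_{pp'}: x\succeq p\succ y\}$, which is a closed interval. (iv) For $x\succ y$: $v^\pi_{xy}=\max\gamma_{xy}$, $v^\pi_{yx}=\min\gamma_{xy}$. The projected scores do not depend on the choice of $\xi$. Rank-like rates: $r_x=N-\sum_{y\ne x}v^\pi_{xy}$. *)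

(* Defs.v *)
From HB Require Import structures.
From mathcomp Require Import all_boot all_order all_algebra.
From mathcomp Require Import boolp classical_sets set_interval reals.

Set Implicit Arguments.
Unset Strict Implicit.
Unset Printing Implicit Defensive.

Import Order.TTheory GRing.Theory Num.Theory.
Local Open Scope ring_scope.

(* A family indexed by the ordered pairs of distinct elements of A is encoded
   as a function A -> A -> R whose diagonal values are never used, and a
   relation on A (a set of such pairs) as an irreflexive rel A. *)

Section Llull.
Variables (R : realType) (A : finType).
Implicit Types (v t tau : A -> A -> R) (xi rho : rel A) (C : {set A}).

Definition llull_matrix v : Prop :=
  forall x y, x != y -> 0 <= v x y <= 1 /\ v x y + v y x <= 1.

Definition collective (K : finType) (alpha : K -> R) (vote : K -> A -> A -> R)
    : A -> A -> R :=
  fun x y => \sum_k alpha k * vote k x y.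

Definition turnover v : A -> A -> R := fun x y => v x y + v y x.

Definition score_cluster C v : Prop :=
  forall a b x, a \in C -> b \in C -> x \notin C ->
    v a x = v b x /\ v x a = v x b.

Definition rel_cluster C rho : Prop :=
  forall x, x \notin C ->
    ((exists2 a, a \in C & rho a x) -> forall b, b \in C -> rho b x) /\
    ((exists2 a, a \in C & rho x a) -> forall b, b \in C -> rho x b).

(* The minimum of v along the path x, p, y, where p lists the intermediate
   vertices. *)
Fixpoint path_score v (x : A) (p : seq A) (y : A) : R :=
  if p is z :: p' then Num.min (v x z) (path_score v z p' y) else v x y.

(* For x != y the set below is nonempty and finite (its elements are scores),
   so that its sup is a maximum. *)
Definition indirect v (x y : A) : R :=
  sup [set path_score v x p y |
        p in [set p | path (fun a b => a != b) x (rcons p y)]]%classic.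

Definition mnu v (x y : A) : R := indirect v x y - indirect v y x.

Definition nu v : rel A := [rel x y | (x != y) && (0 < mnu v x y)].

Definition nu_hat v : rel A := [rel x y | (x != y) && (0 <= mnu v x y)].

Definition strict_total_order xi : Prop :=
  [/\ irreflexive xi, transitive xi & forall x y, x != y -> xi x y || xi y x].

Definition admissible v xi : Prop :=
  [/\ strict_total_order xi, subrel (nu v) xi & subrel xi (nu_hat v)].

Definition weakly xi : rel A := [rel x y | (x == y) || xi x y].

(* y is the immediate successor x' of x *)
Definition next_in xi (x y : A) : bool :=
  xi x y && [forall z, ~~ (xi x z && xi z y)].

(* The default value mnu v x y belongs to the range (p = x, q = y), so that
   this is the plain minimum. *)
Definition msigma v xi (x y : A) : R :=
  \big[Num.min/mnu v x y]_(pq : A * A | weakly xi pq.1 x && weakly xi y pq.2)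
    mnu v pq.1 pq.2.

Definition feasible_turnovers v xi tau : Prop :=
  [/\ forall x y, x != y -> tau x y = tau y x,
      forall x x', next_in xi x x' -> msigma v xi x x' <= tau x x' <= 1 &
      forall x y y', next_in xi y y' -> x != y -> x != y' ->
        0 <= tau x y - tau x y' <= msigma v xi y y'].

Definition turnover_dist v tau : R :=
  \sum_(p : A * A | p.1 != p.2) (tau p.1 p.2 - turnover v p.1 p.2) ^+ 2.

Definition projected_turnovers v xi tau : Prop :=
  feasible_turnovers v xi tau /\
  forall tau', feasible_turnovers v xi tau' ->
    turnover_dist v tau <= turnover_dist v tau'.

Section Projection.
Variables (v : A -> A -> R) (xi : rel A) (tsigma : A -> A -> R).

Definition gamma_next (x x' : A) : set R :=
  `[(tsigma x x' - msigma v xi x x') / 2,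
    (tsigma x x' + msigma v xi x x') / 2]%classic.

Definition gamma (x y : A) : set R :=
  (\bigcup_(pp in [set pp : A * A |
                   [&& weakly xi x pp.1, xi pp.1 y & next_in xi pp.1 pp.2]])
    gamma_next pp.1 pp.2)%classic.

(* gamma is a closed interval, so that sup and inf are its max and min *)
Definition projected_score (x y : A) : R :=
  if xi x y then sup (gamma x y) else inf (gamma y x).

Definition rank_like_rate (x : A) : R :=
  #|A|%:R - \sum_(y | y != x) projected_score x y.

Definition rate_ranking : rel A :=
  [rel x y | (x != y) && (rank_like_rate x < rank_like_rate y)].

End Projection.

End Llull.

(* Main.v *)
(* The rate difference of two consecutive alternatives x, x' of xi is at least
   m^sigma_xx', and it vanishes when m^sigma_xx' = 0.  Hence r_x < r_y iff some
   set U contains x but not y and satisfies m^nu_ul > 0 for all u in U and l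
   outside U; in particular only the feasibility of the projected turnovers
   matters.  Clusters pass from the votes to the indirect scores and to m^nu,
   and such a set U remains of the same kind when a cluster meeting U is added
   to it, or when a cluster not included in U is removed from it. *)

Require Import Defs.
From HB Require Import structures.
From mathcomp Require Import all_boot all_order all_algebra.
From mathcomp Require Import boolp classical_sets set_interval reals.
From mathcomp Require Import real_interval lra.

Set Implicit Arguments.
Unset Strict Implicit.
Unset Printing Implicit Defensive.

Import Order.TTheory GRing.Theory Num.Theory.
Local Open Scope ring_scope.

(** * Clusters of scores, and cuts with positive margins *)

Section Clusters.
Variables (R : realType) (A : finType).
Implicit Types (v : A -> A -> R) (C U : {set A}).

Lemma score_cluster_collective (K : finType) (alpha : K -> R)
    (vote : K -> A -> A -> R) C :
  (forall k, score_cluster C (vote k)) ->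
  score_cluster C (collective alpha vote).
Proof.
move=> clC a b x aC bC xC; rewrite /collective.
by split; apply: eq_bigr => k _; have [e1 e2] := clC k a b x aC bC xC;
  rewrite ?e1 ?e2.
Qed.

Local Notation distinct := (fun a b : A => a != b).

(* Cut the path at its last vertex in C; the rest can be started at b. *)
Lemma path_score_out v C a b x p : score_cluster C v ->
  a \in C -> b \in C -> x \notin C -> path distinct a (rcons p x) ->
  exists2 q, path distinct b (rcons q x) &
    path_score v a p x <= path_score v b q x.
Proof.
move=> clC + bC xC.
elim: p a => [|z p IHp] a aC /=.
  move=> _; exists [::] => /=; last by rewrite (clC a b x aC bC xC).1.
  by rewrite andbT; apply: contraNneq xC => <-.
move=> /andP[az pth]; have [zC|zC] := boolP (z \in C).
  have [q qp le_q] := IHp z zC pth.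
  by exists q => //; rewrite ge_min le_q orbT.
exists (z :: p) => /=; last by rewrite (clC a b z aC bC zC).1.
by rewrite pth andbT; apply: contraNneq zC => <-.
Qed.

(* Cut the path at its first vertex in C. *)
Lemma path_score_in v C a b x p : score_cluster C v ->
  a \in C -> b \in C -> x \notin C -> path distinct x (rcons p a) ->
  exists2 q, path distinct x (rcons q b) &
    path_score v x p a <= path_score v x q b.
Proof.
move=> clC aC bC.
elim: p x => [|z p IHp] x xC /=.
  move=> _; exists [::] => /=; last by rewrite (clC a b x aC bC xC).2.
  by rewrite andbT; apply: contraNneq xC => ->.
move=> /andP[xz pth]; have [zC|zC] := boolP (z \in C).
  exists [::] => /=; last by rewrite ge_min (clC b z x bC zC xC).2 lexx.
  by rewrite andbT; apply: contraNneq xC => ->.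
have [q qp le_q] := IHp z zC pth.
by exists (z :: q) => /=; [rewrite xz | rewrite le_min !ge_min lexx le_q orbT].
Qed.

(** Each set of path scores is dominated by the other, so both have the same down-closure and hence
    the same supremum; no maximal path has to be exhibited. *)
Lemma indirect_eq v x y x' y' :
  (forall p, path distinct x (rcons p y) ->
    exists2 q, path distinct x' (rcons q y') &
      path_score v x p y <= path_score v x' q y') ->
  (forall p, path distinct x' (rcons p y') ->
    exists2 q, path distinct x (rcons q y) &
      path_score v x' p y' <= path_score v x q y) ->
  indirect v x y = indirect v x' y'.
Proof.
move=> le1 le2; rewrite /indirect -[LHS]sup_down -[RHS]sup_down.
congr sup; apply/seteqP; split => r /downP[_ [p pp <-] rp]; apply/downP.
  have [q pq le_pq] := le1 p pp.
  by exists (path_score v x' q y'); [exists q | exact: le_trans le_pq].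
have [q pq le_pq] := le2 p pp.
by exists (path_score v x q y); [exists q | exact: le_trans le_pq].
Qed.

Lemma score_cluster_indirect v C :
  score_cluster C v -> score_cluster C (indirect v).
Proof.
move=> clC a b x aC bC xC; split; apply: indirect_eq => p pp.
- exact: (path_score_out clC aC bC xC pp).
- exact: (path_score_out clC bC aC xC pp).
- exact: (path_score_in clC aC bC xC pp).
- exact: (path_score_in clC bC aC xC pp).
Qed.

Lemma score_cluster_mnu v C : score_cluster C v -> score_cluster C (mnu v).
Proof.
move=> /score_cluster_indirect clC a b x aC bC xC.
by have [e1 e2] := clC a b x aC bC xC; rewrite /mnu e1 e2.
Qed.

(** No order is mentioned, yet such a set is an initial segment of every admissible order, because
    these orders contain [nu]. *)
Definition strict_cut v U : Prop :=
  forall u l, u \in U -> l \notin U -> 0 < mnu v u l.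

(** The elements added to [U] lie in [C], so their margins over any [l] outside [C] are those of
    [a]. *)
Lemma strict_cutU v C U a : score_cluster C v -> a \in C -> a \in U ->
  strict_cut v U -> strict_cut v (U :|: C).
Proof.
move=> /score_cluster_mnu clC aC aU cutU u l.
rewrite !inE negb_or => uUC /andP[lU lC].
have [uU|/negPf uU] := boolP (u \in U); first exact: cutU.
by rewrite uU /= in uUC; rewrite (clC u a l uUC aC lC).1 cutU.
Qed.

(** Dually, the margin of any [u] outside [C] over an element removed from [U] is its margin over
    [a]. *)
Lemma strict_cutD v C U a : score_cluster C v -> a \in C -> a \notin U ->
  strict_cut v U -> strict_cut v (U :\: C).
Proof.
move=> /score_cluster_mnu clC aC aU cutU u l.
rewrite !inE negb_and negbK => /andP[uC uU] lUC.
have [lU|lU] := boolP (l \in U); last exact: cutU.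
by rewrite lU orbF in lUC; rewrite (clC l a u lUC aC uC).2 cutU.
Qed.

End Clusters.

(** * Immediate neighbours and induction in a finite strict total order *)

Section StrictTotalOrder.
Variables (A : finType) (xi : rel A).
Hypothesis xi_ord : strict_total_order xi.

Lemma xi_asym x y : xi x y -> xi y x = false.
Proof.
case: xi_ord => irr tr _ xy; apply/negP => yx.
by have := tr _ _ _ xy yx; rewrite irr.
Qed.

Lemma xi_neq x y : xi x y -> x != y.
Proof. by case: xi_ord => irr _ _ xy; apply: contraTneq xy => ->; rewrite irr. Qed.

Lemma weaklyNgt x y : weakly xi x y = ~~ xi y x.
Proof.
case: (xi_ord) => irr _ tot; rewrite /weakly /=.
have [->|ne /=] := eqVneq x y; first by rewrite irr.
by apply/idP/idP => [/xi_asym->//|/negPf yx]; have := tot _ _ ne; rewrite yx orbF.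
Qed.

Lemma weakly_xi_trans y x z : weakly xi x y -> xi y z -> xi x z.
Proof.
by case: xi_ord => _ tr _ /predU1P[->//|xy yz]; exact: tr xy yz.
Qed.

Lemma xi_weakly_trans y x z : xi x y -> weakly xi y z -> xi x z.
Proof.
by case: xi_ord => _ tr _ xy /predU1P[<-//|yz]; exact: tr xy yz.
Qed.

Lemma weakly_trans y x z : weakly xi x y -> weakly xi y z -> weakly xi x z.
Proof.
move=> /predU1P[->//|xy] yz.
by apply/orP; right; exact: xi_weakly_trans xy yz.
Qed.

Lemma next_xi x x' : next_in xi x x' -> xi x x'.
Proof. by case/andP. Qed.

Lemma next_weaklyr x x' z : next_in xi x x' -> xi x z -> weakly xi x' z.
Proof.
by case/andP=> _ /forallP/(_ z) + xz; rewrite xz weaklyNgt.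
Qed.

Lemma next_weaklyl x x' z : next_in xi x x' -> xi z x' -> weakly xi z x.
Proof.
by case/andP=> _ /forallP/(_ z) + zx'; rewrite zx' andbT weaklyNgt.
Qed.

Lemma next_func x x' x'' : next_in xi x x' -> next_in xi x x'' -> x' = x''.
Proof.
move=> nx nx'; have := next_weaklyr nx (next_xi nx').
move=> /predU1P[//|/xi_asym].
by have /predU1P[->//|->] := next_weaklyr nx' (next_xi nx).
Qed.

(** The number of elements below serves as a rank: it selects immediate neighbours and is the
    measure for induction along the order. *)
Lemma xi_card x y : xi x y -> (#|[pred z | xi y z]| < #|[pred z | xi x z]|)%N.
Proof.
case: (xi_ord) => irr tr _ xy; apply/proper_card/properP; split.
  by apply/fintype.subsetP => z; rewrite !inE; exact: tr xy.
by exists y; rewrite !inE ?irr.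
Qed.

Lemma next_exists x y : xi x y -> exists2 x', next_in xi x x' & weakly xi x' y.
Proof.
(* An element strictly between [x] and [x'] would have more elements below it than [x']; [y]
   witnesses that the range is nonempty. *)
move=> xy; pose x' := [arg max_(z > y | xi x z) #|[pred w | xi z w]|].
have nx : next_in xi x x'.
  rewrite /x'; case: arg_maxnP => // z xz zmax; apply/andP; split=> //.
  apply/forallP => w; apply/negP => /andP[xw wz].
  by have := xi_card wz; rewrite ltnNge => /negP; apply; exact: zmax.
by exists x' => //; exact: next_weaklyr nx xy.
Qed.

Lemma prev_exists x y : xi x y -> exists2 w, next_in xi w y & weakly xi x w.
Proof.
move=> xy; pose w := [arg min_(z < x | xi z y) #|[pred u | xi z u]|].
have nw : next_in xi w y.
  rewrite /w; case: arg_minnP => // z zy zmin; apply/andP; split=> //.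
  apply/forallP => u; apply/negP => /andP[zu uy].
  by have := xi_card zu; rewrite ltnNge => /negP; apply; exact: zmin.
by exists w => //; exact: next_weaklyl nw xy.
Qed.

(** With [y] fixed, strong induction on the number of elements below [x], which drops when [x] is
    replaced by its successor. *)
Lemma chain_ind (P : A -> A -> Prop) : (forall x, P x x) ->
  (forall x x' y, next_in xi x x' -> weakly xi x' y -> P x' y -> P x y) ->
  forall x y, weakly xi x y -> P x y.
Proof.
move=> P0 PS x y; have [n] := ubnP #|[pred z | xi x z]|.
elim: n x => // n IHn x le_n /predU1P[->//|xy].
have [x' nx x'y] := next_exists xy.
apply: (PS _ _ _ nx x'y (IHn _ _ x'y)).
exact: leq_trans (xi_card (next_xi nx)) _.
Qed.

End StrictTotalOrder.

(** * Projected margins of an admissible order *)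

Section Rates.
Variables (R : realType) (A : finType) (v : A -> A -> R) (xi : rel A).
Variable tsigma : A -> A -> R.
Hypothesis adm : admissible v xi.
Hypothesis feas : feasible_turnovers v xi tsigma.

Let xi_ord : strict_total_order xi. Proof. by case: adm. Qed.

Local Notation m := (msigma v xi).
Local Notation ps := (projected_score v xi tsigma).
Local Notation rate := (rank_like_rate v xi tsigma).
Local Notation gam := (gamma v xi tsigma).
Local Notation gam1 := (gamma_next v xi tsigma).

Lemma msigma_ge0 x y : xi x y -> 0 <= m x y.
Proof.
case: adm => _ _ sub xy; apply: le_bigmin => [|[p q] /= /andP[px yq]].
  by have /andP[] := sub _ _ xy.
have := xi_weakly_trans xi_ord (weakly_xi_trans xi_ord px xy) yq.
by move=> /sub /andP[].
Qed.

(** As [U] is an initial segment of [xi], every [p] at or above [x] is in [U] and every [q] at or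
    below [y] is outside, so the finite minimum is over positive margins. *)
Lemma strict_cut_msigma U x y : strict_cut v U -> x \in U -> y \notin U ->
  xi x y -> 0 < m x y.
Proof.
have nu_xi u l : u != l -> 0 < mnu v u l -> xi u l.
  by case: adm => _ sub _ ul mul; apply: sub; rewrite /nu /= ul.
have nin u l : u \in U -> l \notin U -> u != l.
  by move=> uU; apply: contraNneq => <-.
move=> cutU xU yU xy; apply: lt_bigmin => [|[p q] /= /andP[px yq]].
  exact: cutU.
apply: (cutU p q).
  apply: contraTT px => pU; rewrite weaklyNgt // negbK.
  by apply: nu_xi; [exact: nin | exact: cutU].
apply: contraTN yq => qU; rewrite weaklyNgt // negbK.
by apply: nu_xi; [exact: nin | exact: cutU].
Qed.

(** For consecutive [x] and [x'], the pairs in the minimum are exactly those going from this initial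
    segment to its complement. *)
Lemma msigma_strict_cut x x' : next_in xi x x' -> 0 < m x x' ->
  strict_cut v [set u | weakly xi u x].
Proof.
move=> nx m_gt0 u l; rewrite !inE => ux lx.
apply: lt_le_trans m_gt0 _; apply: (bigmin_inf (u, l)) => /=; last exact: lexx.
rewrite ux /=; apply: next_weaklyr nx _ => //.
by move: lx; rewrite weaklyNgt // negbK.
Qed.

(** * Intervals [gamma] and projected scores *)

Lemma gamma_next_le x x' : next_in xi x x' ->
  (tsigma x x' - m x x') / 2 <= (tsigma x x' + m x x') / 2.
Proof.
by move=> nx; have := msigma_ge0 (next_xi nx); lra.
Qed.

Lemma gamma_next_sub x x' y : next_in xi x x' -> xi x y ->
  (gam1 x x' `<=` gam x y)%classic.
Proof.
by move=> nx xy r rx; exists (x, x') => //=; rewrite /weakly /= eqxx xy nx.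
Qed.

Lemma gamma_subset x y x1 y1 : weakly xi x1 x -> weakly xi y y1 ->
  (gam x y `<=` gam x1 y1)%classic.
Proof.
move=> xx yy r [[p p'] /and3P[/= xp py np] rp]; exists (p, p') => //=.
by rewrite np (weakly_trans xi_ord xx xp) (xi_weakly_trans xi_ord py yy).
Qed.

(** A crude bound, summed over all pairs, that makes [sup] and [inf] monotone under inclusion of
    these sets. *)
Lemma gamma_bounded x y : exists b, forall r, gam x y r -> `|r| <= b.
Proof.
pose f (p : A * A) := `|tsigma p.1 p.2| + `|m p.1 p.2|.
exists (\sum_p f p) => r [p _].
have: f p <= \sum_p f p.
  by rewrite (bigD1 p) //= lerDl sumr_ge0 // => q _; rewrite addr_ge0.
rewrite /f /gamma_next /= in_itv /= ler_norml.
have := ler_norm (tsigma p.1 p.2); have := ler_norm (m p.1 p.2).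
have := ler_norm (- tsigma p.1 p.2); have := ler_norm (- m p.1 p.2).
rewrite !normrN; lra.
Qed.

Lemma gamma_has_ubound x y : has_ubound (gam x y).
Proof.
have [b bP] := gamma_bounded x y.
by exists b => r /bP; exact: le_trans (ler_norm r).
Qed.

Lemma gamma_has_lbound x y : has_lbound (gam x y).
Proof.
have [b bP] := gamma_bounded x y.
by exists (- b) => r /bP; rewrite ler_norml => /andP[].
Qed.

Lemma gamma_neq0 x y : xi x y -> (gam x y !=set0)%classic.
Proof.
move=> xy; have [x' nx _] := next_exists xi_ord xy.
exists ((tsigma x x' - m x x') / 2); apply: (gamma_next_sub nx xy).
by rewrite /gamma_next /= in_itv /= lexx gamma_next_le.
Qed.

Lemma sup_gamma_le x y x1 y1 : weakly xi x1 x -> weakly xi y y1 -> xi x y ->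
  sup (gam x y) <= sup (gam x1 y1).
Proof.
move=> xx yy xy; apply: ge_sup (gamma_neq0 xy) _ => r /(gamma_subset xx yy).
exact: ub_le_sup (gamma_has_ubound _ _) _.
Qed.

Lemma inf_gamma_le x y x1 y1 : weakly xi x1 x -> weakly xi y y1 -> xi x y ->
  inf (gam x1 y1) <= inf (gam x y).
Proof.
move=> xx yy xy; apply: lb_le_inf (gamma_neq0 xy) _ => r /(gamma_subset xx yy).
exact: ge_inf (gamma_has_lbound _ _) _.
Qed.

Lemma gamma_step x x' : next_in xi x x' -> gam x x' = gam1 x x'.
Proof.
move=> nx; apply/seteqP; split; last exact: gamma_next_sub (next_xi nx).
move=> r [[p p'] /and3P[/= xp px' np] rp].
have := next_weaklyl xi_ord nx px'; rewrite weaklyNgt // => xNp.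
have /eqP px : p == x by move: xp; rewrite /weakly /= (negPf xNp) orbF eq_sym.
by subst p; rewrite (next_func xi_ord nx np).
Qed.

Lemma gamma_consl x x' z : next_in xi x x' -> xi x' z ->
  (gam x z `<=` gam1 x x' `|` gam x' z)%classic.
Proof.
move=> nx x'z r [[p p'] /and3P[/= /predU1P[<-|xp] pz np] rp].
  by left; rewrite (next_func xi_ord nx np).
by right; exists (p, p') => //=; rewrite pz np (next_weaklyr xi_ord nx xp).
Qed.

Lemma gamma_consr x x' z : next_in xi x x' -> xi z x ->
  (gam z x' `<=` gam z x `|` gam1 x x')%classic.
Proof.
move=> nx zx r [[p p'] /and3P[/= zp px' np] rp].
have /predU1P[px|px] := next_weaklyl xi_ord nx px'.
  by subst p; right; rewrite (next_func xi_ord nx np).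
by left; exists (p, p') => //=; rewrite zp px np.
Qed.

(** As [z] is not between [x] and [x'], the two intervals are nested: the one of [x] is larger when
    [z] comes after, where [sup] counts, and smaller when [z] comes before, where [inf] counts. *)
Lemma projected_score_next_le x x' z : next_in xi x x' -> z != x -> z != x' ->
  ps x' z <= ps x z.
Proof.
move=> nx zx zx'; have xx' := next_xi nx.
have wxx : weakly xi x x' by rewrite /weakly /= xx' orbT.
rewrite /projected_score; have [xz|xz] := boolP (xi x z).
  have : weakly xi x' z by exact: next_weaklyr nx xz.
  rewrite /weakly /= eq_sym (negPf zx') /= => x'z.
  by rewrite x'z; apply: sup_gamma_le => //; rewrite /weakly /= eqxx.
have zx1 : xi z x by move: xz; rewrite -weaklyNgt // /weakly /= (negPf zx).
have zx1' : xi z x' by exact: xi_weakly_trans zx1 wxx.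
rewrite (xi_asym xi_ord zx1').
by apply: inf_gamma_le => //; rewrite /weakly /= eqxx.
Qed.

(* When m x x' = 0, the feasibility constraints force gam1 x x', reduced to
   tsigma x x' / 2, into the adjacent intervals on both sides. *)
Lemma projected_score_next_eq x x' z : next_in xi x x' -> z != x -> z != x' ->
  m x x' = 0 -> ps x z = ps x' z.
Proof.
case: feas => tsym _ tstep nx zx zx' m0; have xx' := next_xi nx.
have xNx' := xi_neq xi_ord xx'.
have wxx : weakly xi x x' by rewrite /weakly /= xx' orbT.
have w0 w : weakly xi w w by rewrite /weakly /= eqxx.
(* The step constraint bounds this difference between 0 and [m x x' = 0]. *)
have teq w : w != x -> w != x' -> tsigma w x = tsigma w x'.
  by move=> wx wx'; have := tstep w x x' nx wx wx'; rewrite m0; lra.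
rewrite /projected_score; have [xz|xz] := boolP (xi x z).
  have : weakly xi x' z by exact: next_weaklyr nx xz.
  rewrite /weakly /= eq_sym (negPf zx') /= => x'z.
  rewrite x'z; congr sup; apply/seteqP; split; last exact: gamma_subset.
  move=> r /(gamma_consl nx x'z)[|//].
  have [x'' nx' _] := next_exists xi_ord x'z.
  move=> rx; apply: (gamma_next_sub nx' x'z); move: rx.
  have x'x'' := next_xi nx'.
  have x'Nx'' := xi_neq xi_ord x'x''.
  have xNx'' : x != x''.
    by apply: contraTneq x'x'' => <-; rewrite (xi_asym xi_ord xx').
  (* Since [tsigma x x''] equals [tsigma x' x''], this places [tsigma x x' / 2] in the upper half of
     [gam1 x' x'']. *)
  have := tstep x x' x'' nx' xNx' xNx''.
  rewrite (tsym x x'' xNx'') teq 1?eq_sym // (tsym x'' x') 1?eq_sym //.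
  rewrite /gamma_next /= !in_itv /= m0; lra.
have zx1 : xi z x by move: xz; rewrite -weaklyNgt // /weakly /= (negPf zx).
have zx1' : xi z x' by exact: xi_weakly_trans zx1 wxx.
rewrite (xi_asym xi_ord zx1').
congr inf; apply/seteqP; split; first exact: gamma_subset.
move=> r /(gamma_consr nx zx1)[//|].
have [w nw zw] := prev_exists xi_ord zx1; have wx := next_xi nw.
move=> rx; apply: (gamma_subset zw (w0 x)).
apply: (gamma_next_sub nw wx); move: rx.
have wNx := xi_neq xi_ord wx.
have wNx' : w != x'.
  by apply: contraTneq wx => ->; rewrite (xi_asym xi_ord xx').
(* Since [tsigma x' w] equals [tsigma w x], this places [tsigma x x' / 2] in the lower half of
   [gam1 w x]. *)
have := tstep x' w x nw; rewrite eq_sym wNx' eq_sym xNx' => /(_ isT isT).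
rewrite (tsym x' w) 1?eq_sym // -teq // (tsym x' x) 1?eq_sym //.
rewrite /gamma_next /= !in_itv /= m0; lra.
Qed.

(** * Rate differences and their relation to cuts *)

Lemma projected_score_next_diff x x' : next_in xi x x' ->
  ps x x' - ps x' x = m x x'.
Proof.
move=> nx; have xx' := next_xi nx; have le12 := gamma_next_le nx.
rewrite /projected_score xx' (xi_asym xi_ord xx') (gamma_step nx).
by rewrite /gamma_next sup_itvcc // inf_itvcc //; lra.
Qed.

Lemma rate_next_diff x x' : next_in xi x x' ->
  rate x' - rate x =
  m x x' + \sum_(z | (z != x) && (z != x')) (ps x z - ps x' z).
Proof.
move=> nx; have xNx' := xi_neq xi_ord (next_xi nx).
(* The two mutual scores of [x] and [x'] are split off, as their difference is [m x x']; the
   remaining sums have the same range. *)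
rewrite /rank_like_rate [\sum_(y | y != x') _](bigD1 x) //=.
rewrite [\sum_(y | y != x) _](bigD1 x') 1?eq_sym //= sumrB.
rewrite -(projected_score_next_diff nx).
rewrite (eq_bigl (fun z => (z != x) && (z != x'))) => [|z]; last exact: andbC.
by lra.
Qed.

Lemma rate_next_ge x x' : next_in xi x x' -> m x x' <= rate x' - rate x.
Proof.
move=> nx; rewrite (rate_next_diff nx) lerDl sumr_ge0 // => z /andP[zx zx'].
by rewrite subr_ge0; exact: projected_score_next_le.
Qed.

Lemma rate_next_eq x x' : next_in xi x x' -> m x x' = 0 -> rate x = rate x'.
Proof.
move=> nx m0; apply/eqP; rewrite eq_sym -subr_eq0 rate_next_diff // m0 add0r.
rewrite big1 // => z /andP[zx zx'].
by rewrite (projected_score_next_eq nx zx zx' m0) subrr.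
Qed.

Lemma rate_next_le x x' : next_in xi x x' -> rate x <= rate x'.
Proof.
move=> nx; rewrite -subr_ge0; apply: le_trans (rate_next_ge nx).
exact: msigma_ge0 (next_xi nx).
Qed.

Lemma rate_mono x y : weakly xi x y -> rate x <= rate y.
Proof.
move: x y; apply: (chain_ind xi_ord) => // x x' y nx _.
exact: le_trans (rate_next_le nx).
Qed.

(** Going down from [x] to [y], the chain leaves [U] at some step; the rate increases strictly there
    and never decreases elsewhere. *)
Lemma strict_cut_rate_lt U x y : strict_cut v U -> x \in U -> y \notin U ->
  rate x < rate y.
Proof.
move=> cutU xU yU; have xNy : x != y by apply: contraNneq yU => <-.
have : weakly xi x y.
  by case: adm => _ sub _; rewrite /weakly /= sub ?orbT // /nu /= xNy cutU.
move=> wxy; move: x y wxy xU yU {xNy}; apply: (chain_ind xi_ord).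
  by move=> x ->.
move=> x x' y nx x'y IH xU yU; have [x'U|x'U] := boolP (x' \in U).
  exact: le_lt_trans (rate_next_le nx) (IH x'U yU).
apply: lt_le_trans (rate_mono x'y); rewrite -subr_gt0.
apply: lt_le_trans (rate_next_ge nx).
exact: strict_cut_msigma cutU xU x'U (next_xi nx).
Qed.

(** The chain from [x] to [y] has a first step with positive margin, and the initial segment ending
    there is a cut. *)
Lemma rate_lt_strict_cut x y : rate x < rate y ->
  exists U, [/\ strict_cut v U, x \in U & y \notin U].
Proof.
move=> rxy; have : weakly xi x y.
  rewrite weaklyNgt //; apply: contraTN rxy => yx.
  by rewrite -leNgt rate_mono // /weakly /= yx orbT.
move=> wxy; move: x y wxy rxy.
apply: (chain_ind xi_ord) => [x|x x' y nx x'y IH rxy].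
  by rewrite ltxx.
have [m0|m_neq0] := eqVneq (m x x') 0.
  have [|U [cutU x'U yU]] := IH; first by rewrite -(rate_next_eq nx m0).
  (* The cut found for [x'] also contains [x]: it cannot separate elements of equal rate. *)
  exists U; split=> //; have [//|xU] := boolP (x \in U).
  by have := strict_cut_rate_lt cutU x'U xU; rewrite (rate_next_eq nx m0) ltxx.
exists [set u | weakly xi u x]; split.
- apply: (msigma_strict_cut nx).
  by rewrite lt_def m_neq0 msigma_ge0 // next_xi.
- by rewrite inE /weakly /= eqxx.
- by rewrite inE weaklyNgt // negbK (xi_weakly_trans xi_ord (next_xi nx)).
Qed.

End Rates.

Theorem theorem16p6 (R : realType) (A K : finType)
    (alpha : K -> R) (vote : K -> A -> A -> R) (C : {set A})
    (xi : rel A) (tsigma : A -> A -> R) :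
  (forall k, llull_matrix (vote k)) ->
  (forall k, 0 <= alpha k) ->
  \sum_k alpha k = 1 ->
  (forall k, score_cluster C (vote k)) ->
  admissible (collective alpha vote) xi ->
  projected_turnovers (collective alpha vote) xi tsigma ->
  rel_cluster C (rate_ranking (collective alpha vote) xi tsigma).
Proof.
move=> _ _ _ clk adm [feas _] x xC.
have clC := score_cluster_collective alpha clk.
split=> -[a aC /andP[_ /(rate_lt_strict_cut adm feas)[U [cutU]]]] + + b bC.
  (* Here [a] is in the cut and [x] is not; adding [C] brings [b] in and keeps [x] out. *)
  move=> aU xU; apply/andP; split; first by apply: contraNneq xC => <-.
  apply: (strict_cut_rate_lt _ adm (strict_cutU clC aC aU cutU)).
    by rewrite inE bC orbT.
  by rewrite inE negb_or xU.
(* Here [x] is in the cut and [a] is not; removing [C] puts [b] out and keeps [x] in. *)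
move=> xU aU; apply/andP; split; first by apply: contraNneq xC => ->.
apply: (strict_cut_rate_lt _ adm (strict_cutD clC aC aU cutU)).
  by rewrite inE xC.
by rewrite inE bC.
Qed.
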